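(* Let $d\ge 2$ and $p\in[0,1]$. Let $F$ be the lowest open Lipschitz function. Let $(g_y:y\in\mathbb Z^{d-1})$ be independent random functions on $\mathbb Z^{d-1}$ such that, for each $y\in\mathbb Z^{d-1}$, $g_y$ has the same law as the local cover $\overline f_y$ at $y$ under $\mathbb P_p$, and let $$G(x):=\sup\{g_y(x):y\in\mathbb Z^{d-1}\},\qquad x\in\mathbb Z^{d-1}.$$ Then $F$ is dominated stochastically by $G$, in that, for any increasing (measurable) subset $A\subseteq[0,\infty]^{\mathbb Z^{d-1}}$, $$\mathbb P_p\bigl[(F(x):x\in\mathbb Z^{d-1})\in A\bigr]\le\mathbb P\bigl[(G(x):x\in\mathbb Z^{d-1})\in A\bigr],$$ where $\mathbb P$ is the probability measure governing $(g_y)$.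
   Context: Let $\mathbb Z^+=\{1,2,\dots\}$, $\mathbb Z^+_0=\{0\}\cup\mathbb Z^+$, and let $\|\cdot\|$ be the $\ell^1$-norm. Site percolation on $\mathbb Z^d$ with parameter $p\in[0,1]$: each site is independently open with probability $p$ and closed otherwise; the law is $\mathbb P_p$. A function $f$ on $\mathbb Z^{d-1}$ with values in $\mathbb Z^+_0$ is Lipschitz if $|f(x)-f(y)|\le 1$ for all $x,y\in\mathbb Z^{d-1}$ with $\|x-y\|=1$. A Lipschitz function $F:\mathbb Z^{d-1}\to\mathbb Z^+$ is called open if, for each $x\in\mathbb Z^{d-1}$, the site $(x,F(x))\in\mathbb Z^d$ is open. If an open Lipschitz function exists, the pointwise minimum of all of them is itself an open Lipschitz function, called the lowest open Lipschitz function $F$; if none exists, one sets $F(x)=\infty$ for all $x\in\mathbb Z^{d-1}$. Local cover: for $y\in\mathbb Z^{d-1}$, let $\mathcal F_y$ be the set of Lipschitz functions $f:\mathbb Z^{d-1}\to\mathbb Z^+_0$ such that (a) $f(y)>0$, and (b) for all $x\in\mathbb Z^{d-1}$, either $f(x)=0$ or the site $(x,f(x))$ is open. The local cover at $y$ is the function $\overline f_y(z):=\min\{f(z):f\in\mathcal F_y\}$, $z\in\mathbb Z^{d-1}$, with the convention that $\overline f_y\equiv\infty$ if $\mathcal F_y=\varnothing$. A subset $A\subseteq[0,\infty]^{\mathbb Z^{d-1}}$ is increasing if $a\in A$ and $a\le b$ coordinatewise imply $b\in A$. *)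

(* Defs.v *)
From HB Require Import structures.
From mathcomp Require Import all_boot all_order all_algebra finmap.
From mathcomp Require Import all_classical all_reals all_analysis measurable_realfun.

Set Implicit Arguments.
Unset Strict Implicit.
Unset Printing Implicit Defensive.

Import Order.TTheory GRing.Theory Num.Theory.

Local Open Scope classical_set_scope.
Local Open Scope ring_scope.

Definition l1norm (n : nat) (x : 'rV[int]_n) : nat :=
  (\sum_(i < n) `|x ord0 i|)%N.

Definition lipschitz (n : nat) (f : 'rV[int]_n -> nat) : Prop :=
  forall x y : 'rV[int]_n, l1norm (x - y) = 1%N ->
    `|(f x)%:Z - (f y)%:Z| <= 1.

(* The point (x, h) of Z^d, for x in Z^(d-1): [insub i] is [Some i] for the
   first d - 1 coordinates and [None] for the last one. *)
Definition site (d : nat) (x : 'rV[int]_d.-1) (h : nat) : 'rV[int]_d :=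
  \row_(i < d) oapp (x ord0) h%:Z (insub (i : nat)).

Definition open_lipschitz (d : nat) (o : 'rV[int]_d -> bool)
    (f : 'rV[int]_d.-1 -> nat) : Prop :=
  [/\ lipschitz f, forall x, (0 < f x)%N & forall x, o (site x (f x))].

(* The class of functions whose pointwise minimum is the local cover at y. *)
Definition cover_class (d : nat) (o : 'rV[int]_d -> bool) (y : 'rV[int]_d.-1)
    (f : 'rV[int]_d.-1 -> nat) : Prop :=
  [/\ lipschitz f, (0 < f y)%N & forall x, f x = 0%N \/ o (site x (f x))].

(* Pointwise minimum of a class of nat-valued functions, identically +oo when
   the class is empty; see [pointwise_min0] and [pointwise_min_attained]. *)
Definition pointwise_min (R : realType) (T : Type) (C : set (T -> nat))
    (x : T) : \bar R :=
  ereal_inf [set ((f x)%:R)%:E | f in C].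

Lemma pointwise_min0 (R : realType) (T : Type) (x : T) :
  pointwise_min R set0 x = +oo%E.
Proof. by rewrite /pointwise_min image_set0 ereal_inf0. Qed.

Lemma pointwise_min_attained (R : realType) (T : Type) (C : set (T -> nat))
    (x : T) : C !=set0 ->
  exists2 f, C f & pointwise_min R C x = ((f x)%:R)%:E /\
    (forall g, C g -> (f x <= g x)%N).
Proof.
move=> [f0 Cf0].
have ex : exists n, `[< exists2 f, C f & f x = n >].
  by exists (f0 x); apply/asboolP; exists f0.
case: (ex_minnP ex) => _ /asboolP[f Cf <-] fmin.
have lef g : C g -> (f x <= g x)%N.
  by move=> Cg; apply: fmin; apply/asboolP; exists g.
exists f => //; split => //; apply/eqP; rewrite eq_le; apply/andP; split.
  by apply: ereal_inf_lbound; exists f.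
by apply: le_ereal_inf_tmp => _ [g Cg <-]; rewrite lee_fin ler_nat lef.
Qed.

Definition lowest_open_lipschitz (R : realType) (d : nat)
    (o : 'rV[int]_d -> bool) : 'rV[int]_d.-1 -> \bar R :=
  pointwise_min R [set f | open_lipschitz o f].

Definition local_cover (R : realType) (d : nat)
    (o : 'rV[int]_d -> bool) (y : 'rV[int]_d.-1) : 'rV[int]_d.-1 -> \bar R :=
  pointwise_min R [set f | cover_class o y f].

(* Extended-real functions on Z^n with the product sigma-algebra, i.e. the one
   generated by the coordinate maps. *)
Definition cylinders (R : realType) (n : nat) :
    set (set ('rV[int]_n -> \bar R)) :=
  [set B | exists (x : 'rV[int]_n) (C : set (\bar R)),
     measurable C /\ B = [set a | C (a x)]].

Definition heights (R : realType) (n : nat) :=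
  g_sigma_algebraType (@cylinders R n).

Definition independent_RVs (R : realType) (dT dT' : measure_display)
    (T : measurableType dT) (T' : measurableType dT') (P : probability T R)
    (I : choiceType) (X : I -> {RV P >-> T'}) : Prop :=
  forall (J : {fset I}) (B : I -> set T'), (forall i, measurable (B i)) ->
    P (\bigcap_(i in [set` J]) X i @^-1` B i) =
    (\prod_(i <- J) P (X i @^-1` B i))%E.

(* [omega s w] is true iff the site s is open in the configuration w. *)
Definition site_percolation (R : realType) (dT : measure_display)
    (T : measurableType dT) (P : probability T R) (d : nat) (p : R)
    (omega : 'rV[int]_d -> {RV P >-> bool}) : Prop :=
  independent_RVs omega /\ forall s, P [set w | omega s w] = p%:E.

(* [A] is an increasing subset of [0, +oo]^(Z^n). *)
Definition increasing (R : realType) (n : nat) (A : set (heights R n)) : Prop :=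
  (forall a, A a -> forall x, (0 <= a x)%E) /\
  (forall a b, A a -> (forall x, (a x <= b x)%E) -> A b).

(* Main.v *)
Require Import Defs.
From HB Require Import structures.
From mathcomp Require Import all_boot all_order all_algebra finmap zify.
From mathcomp Require Import all_classical all_reals all_analysis measurable_realfun.

(** Every column [y] gets its own independent percolation configuration
    [eta_y], and [h_y] denotes the local cover at [y] computed in [eta_y].  The
    [h_y] are independent and have the laws of the [g y], so [G] may be
    replaced by [H = sup_y h_y] ([layers_independent], [family_law]).  It then
    suffices to construct, on the same probability space, one percolation
    configuration [o] whose lowest open Lipschitz function lies pointwise
    below [H].

    The explored region of [y] consists of the sites of positive height on or
    below the graph of [h_y].  The states of [eta_y] inside that region already
    determine the region ([explored_stopping]), as with a stopping time.
    Enumerate the columns, and let [o] agree at a site [s] with [eta_y] for the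
    first [y] whose region contains [s], and with a spare configuration if no
    region contains [s].

    - The lowest open Lipschitz function of [o] is at most [H]
      ([lowest_le_sup_covers]).  Suppose [H] is finite at one point.  By the
      Lipschitz property it is finite everywhere, each value [H x] is attained
      by some [h_y], and [H] is positive and Lipschitz.  The first [y] with
      [h_y x = H x] is also the first one whose region contains [(x, H x)], so
      [o] has there the state of [eta_y], which is open.  Hence [H] is an open
      Lipschitz function for [o].

    - [o] is a percolation configuration ([bernoulli_field_merge]).  Heuristically,
      when the regions are explored one after the other, each site of [o] is
      read off a variable that has not been looked at before.  The proof changes
      [o] one region at a time, by exchanges of variables that preserve the
      measure ([probability_hybrid_cons]), and passes to the limit.

    The independent configurations come from the digits of one uniform random
    number ([bernoulli_field_exists]).  The lowest open Lipschitz function and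
    the local covers are minima over uncountable classes; they are measurable
    because a lower bound on a finite minimum is witnessed by a finite path
    ([cover_aboveE]). *)

Set Implicit Arguments.
Unset Strict Implicit.
Unset Printing Implicit Defensive.

Import Order.TTheory GRing.Theory Num.Theory.
Local Open Scope classical_set_scope.
Local Open Scope ring_scope.

(** * Laws of families of random variables *)

(** Dynkin's lemma, for the images of two measures under maps into a set [S] on
    which no sigma-algebra need be given: the preimages of the generated sets
    come out measurable as part of the same induction. *)
Lemma pi_law_unique d1 d2 (R : realType) (T1 : measurableType d1)
    (T2 : measurableType d2) (m1 : {measure set T1 -> \bar R})
    (m2 : {measure set T2 -> \bar R}) (S : Type) (X1 : T1 -> S) (X2 : T2 -> S)
    (G : set (set S)) :
  setI_closed G -> (m1 setT < +oo)%E -> m1 setT = m2 setT ->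
  (forall B, G B -> [/\ measurable (X1 @^-1` B), measurable (X2 @^-1` B) &
     m1 (X1 @^-1` B) = m2 (X2 @^-1` B)]) ->
  forall B, <<s G >> B -> [/\ measurable (X1 @^-1` B), measurable (X2 @^-1` B) &
     m1 (X1 @^-1` B) = m2 (X2 @^-1` B)].
Proof.
move=> GI m1oo m12 GE B; rewrite -setI_closed_g_dynkin_g_sigma_algebra//.
move: B; apply: smallest_sub => //; split.
- by rewrite /= !preimage_setT.
- move=> B [mB1 mB2 eB].
  split; [exact: measurableC mB1|exact: measurableC mB2|].
  rewrite -(preimage_setC X1) -(preimage_setC X2).
  have fin1 : (m1 (X1 @^-1` B) < +oo)%E.
    by apply: le_lt_trans m1oo; apply: le_measure; rewrite ?inE.
  have fin2 : (m2 (X2 @^-1` B) < +oo)%E by rewrite -eB.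
  have m2oo : (m2 setT < +oo)%E by rewrite -m12.
  by rewrite -!setTD !measureD ?setTI//; congr (_ - _)%E.
- move=> F tF HF; rewrite /= !preimage_bigcup; split.
  + by apply: bigcup_measurable => n _; case: (HF n).
  + by apply: bigcup_measurable => n _; case: (HF n).
  + have tp T (X : T -> S) : trivIset setT (fun n => X @^-1` F n).
      by move=> i j _ _ [t [Fi Fj]]; apply: tF => //; exists (X t).
    rewrite !measure_bigcup ?tp//=; try by move=> n _; case: (HF n).
    by apply: eq_eseriesr => n _; case: (HF n).
Qed.

(** Only the events that finitely many sites are open are taken as generators.
    They form a pi-system, so a law on configurations is determined by them. *)
Definition open_cylinders (J : choiceType) : set (set (J -> bool)) :=
  [set B | exists S : {fset J}, B = [set x : J -> bool | forall j, j \in S -> x j]].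

Definition configs (J : choiceType) := g_sigma_algebraType (@open_cylinders J).

Lemma open_cylinders_setI (J : choiceType) : setI_closed (@open_cylinders J).
Proof.
move=> _ _ [S ->] [S' ->]; exists (S `|` S')%fset; apply/seteqP; split=> x /=.
  by move=> [h h'] j; rewrite inE => /orP[/h|/h'].
by move=> h; split=> j jS; apply: h; rewrite inE jS ?orbT.
Qed.

Lemma measurable_fset_forall d (T : measurableType d) (J : choiceType)
    (S : {fset J}) (E : J -> set T) : (forall j, measurable (E j)) ->
  measurable [set t | forall j, j \in S -> E j t].
Proof.
move=> mE; rewrite (_ : [set t | _] = \bigcap_(j in [set` S]) E j).
  exact: fin_bigcap_measurable.
by apply/seteqP; split => t /= h j; apply: h.
Qed.

Lemma measurable_cst_prop d (T : measurableType d) (Z : Prop) :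
  measurable [set _ : T | Z].
Proof.
have [z|z] := pselect Z.
  rewrite (_ : [set _ | _] = setT); first exact: measurableT.
  by apply/seteqP; split.
rewrite (_ : [set _ | _] = set0); first exact: measurable0.
by apply/seteqP; split.
Qed.

Lemma measurable_configs d (T : measurableType d) (J : choiceType)
    (X : T -> configs J) :
  (forall j, measurable [set t | X t j]) -> measurable_fun setT X.
Proof.
move=> mX.
apply: (@measurability _ _ T (configs J) setT X (@open_cylinders J) erefl).
move=> _ [_ [S ->] <-]; rewrite setTI.
exact: (@measurable_fset_forall _ _ _ S (fun j => [set t | X t j])).
Qed.

Lemma measurable_site_open (J : choiceType) (j : J) :
  measurable [set x : configs J | x j].
Proof.
apply: sub_sigma_algebra; exists [fset j]%fset; apply/seteqP; split=> x /=.
  by move=> xj i; rewrite inE => /eqP ->.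
by apply; rewrite inE.
Qed.

(** Independent variables, each true with probability [p]: the events that all
    sites of a finite set are true are enough to express this. *)
Definition bernoulli_field (R : realType) (p : R) d (T : measurableType d)
    (P : probability T R) (J : choiceType) (X : T -> J -> bool) : Prop :=
  (forall j, measurable [set t | X t j]) /\
  (forall S : {fset J}, P [set t | forall j, j \in S -> X t j] =
     (p ^+ #|` S|)%:E).

Lemma bernoulli_field_law (R : realType) (p : R) d (T : measurableType d)
    (P : probability T R) d' (T' : measurableType d') (P' : probability T' R)
    (J : choiceType) (X : T -> J -> bool) (X' : T' -> J -> bool) :
  bernoulli_field p P X -> bernoulli_field p P' X' ->
  forall B : set (configs J), measurable B ->
  P [set t | B (X t)] = P' [set t | B (X' t)].
Proof.
move=> [mX PX] [mX' PX'] B mB.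
have [|||_ _ //] := @pi_law_unique _ _ R _ _ P P' _ X X' _
  (@open_cylinders_setI J) _ _ _ B mB.
- by apply: le_lt_trans (ltry 1); rewrite -(probability_setT P).
- exact: (etrans (probability_setT P) (esym (probability_setT P'))).
move=> _ [S ->]; split; last by rewrite [LHS]PX [RHS]PX'.
- exact: (@measurable_fset_forall _ _ _ S (fun j => [set t | X t j])).
- exact: (@measurable_fset_forall _ _ _ S (fun j => [set t | X' t j])).
Qed.

(** This covers permuting the variables, keeping one layer of them, and
    restricting to a half-space. *)
Lemma bernoulli_field_reindex (R : realType) (p : R) d (T : measurableType d)
    (P : probability T R) (J J' : choiceType) (X : T -> J -> bool)
    (f : J' -> J) : injective f ->
  bernoulli_field p P X -> bernoulli_field p P (fun t => X t \o f).
Proof.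
move=> injf [mX PX]; split=> [j|S]; first exact: mX.
have := PX (f @` S)%fset; rewrite card_imfset// => <-; congr (P _).
apply/seteqP; split => t /= h j.
  by move=> /imfsetP[i /= iS ->]; exact: h.
by move=> jS; apply: h; apply/imfsetP; exists j.
Qed.

(** * Independent Bernoulli variables from a uniform number *)

Lemma uniform_prob01_itv (R : realType) (a b : R) : 0 <= a -> a <= b -> b <= 1 ->
  uniform_prob (@ltr01 R) `[a, b[%classic = (b - a)%:E.
Proof.
move=> a0 ab b1; rewrite /uniform_prob (eq_integral (fun=> 1%E)); last first.
  move=> x; rewrite inE/= in_itv/= => /andP[ax xb]; rewrite /uniform_pdf.
  by rewrite (le_trans a0 ax) (ltW (lt_le_trans xb b1)) /= subr0 invr1.
rewrite integral_cst//= mul1e lebesgue_measure_itv/= lte_fin.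
by case: ltgtP ab => // -> _; rewrite subrr.
Qed.

Lemma probability_setI_full d (T : measurableType d) (R : realType)
    (P : probability T R) (A U : set T) : measurable A -> measurable U ->
  P A = 1%E -> P (U `&` A) = P U.
Proof.
move=> mA mU PA; suff PUA : P (U `\` A) = 0%E.
  apply/esym; apply: (etrans (measureDI P mU mA)).
  by rewrite -[RHS]add0e; congr (_ + _)%E; exact: PUA.
apply: (@subset_measure0 _ _ _ P _ (~` A)) => //; first exact: measurableD.
- exact: measurableC.
- by apply: (etrans (probability_setC P mA)); rewrite PA subee.
Qed.

Section BernoulliDigits.
Context {R : realType} (p : R) (p0 : 0 <= p) (p1 : p <= 1).

(** The first digit of [x], for [0 <= x < 1], is true if [x < p].  Each of the two
    intervals so obtained is rescaled to length 1 to define the next digits.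
    For [p = 1/2] this is the binary expansion. *)
Definition digit_shift (x : R) : R :=
  if x < p then x / p else (x - p) / (1 - p).

Definition digit_fits (o : option bool) (x : R) : bool :=
  if o is Some b then (x < p) == b else true.

(** A pattern prescribes the digits, [None] standing for an arbitrary one. *)
Fixpoint digits_match (s : seq (option bool)) (x : R) : bool :=
  if s is o :: s' then digit_fits o x && digits_match s' (digit_shift x)
  else true.

Definition digit_weight (o : option bool) : R :=
  if o is Some b then (if b then p else 1 - p) else 1.

Definition pattern_weight (s : seq (option bool)) : R :=
  \prod_(o <- s) digit_weight o.

(** Prepending a digit contracts an interval affinely, so the points with given
    first digits form an interval, whose length is the product of the weights. *)
Lemma digits_match_itv (bs : seq bool) : exists a : R,
  [/\ 0 <= a, 0 <= pattern_weight (map Some bs),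
      a + pattern_weight (map Some bs) <= 1
    & forall x, (0 <= x < 1) && digits_match (map Some bs) x =
        (a <= x < a + pattern_weight (map Some bs))].
Proof.
elim: bs => [|b bs [a [a0 w0 aw1 IH]]] /=.
  exists 0; rewrite /pattern_weight big_nil add0r; split => // x.
  by rewrite andbT.
rewrite /pattern_weight big_cons -/(pattern_weight _).
set w := pattern_weight _ in w0 aw1 IH *.
case: b => /=.
- exists (p * a); rewrite -mulrDr; split; [exact: mulr_ge0|exact: mulr_ge0| |].
    by rewrite mulr_ile1// (le_trans a0)// lerDl.
  move=> x; rewrite /digit_shift eqb_id.
  have [x0|x0] := leP 0 x; last first.
    by rewrite /= [LHS]/= (lt_geF (lt_le_trans x0 _))// mulr_ge0.
  have [xp|px] := ltP x p; last first.
    rewrite /= andbF; apply/esym/negbTE; rewrite negb_and -leNgt.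
    by rewrite orbC (le_trans _ px)// -[leRHS]mulr1 ler_wpM2l.
  have pp : 0 < p by exact: le_lt_trans xp.
  rewrite (lt_le_trans xp p1)/=; have := IH (x / p).
  by rewrite divr_ge0//= ltr_pdivrMr// mul1r xp/= => ->;
    rewrite ler_pdivlMr// ltr_pdivrMr// ![_ * p]mulrC.
- exists (p + (1 - p) * a); rewrite -addrA -mulrDr.
  have q0 : 0 <= 1 - p by rewrite subr_ge0.
  split; [by rewrite addr_ge0// mulr_ge0|exact: mulr_ge0| |].
    by rewrite -[leRHS](subrKC p) lerD2l -[leRHS]mulr1 ler_wpM2l.
  move=> x; rewrite /digit_shift eqbF_neg -leNgt.
  have [px|xp] := leP p x; last first.
    rewrite andbF; apply/esym/negbTE; rewrite negb_and -ltNge.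
    by rewrite (lt_le_trans xp)// lerDl mulr_ge0.
  rewrite (le_trans p0 px)/=.
  have [x1|x1] := ltP x 1; last first.
    rewrite /=; apply/esym/negbTE; rewrite negb_and -[X in _ || X]leNgt.
    rewrite orbC (le_trans _ x1)// -[leRHS](subrKC p) lerD2l.
    by rewrite -[leRHS]mulr1 ler_wpM2l.
  have qp : 0 < 1 - p by rewrite subr_gt0 (le_lt_trans px).
  have := IH ((x - p) / (1 - p)).
  rewrite divr_ge0 ?subr_ge0//= ltr_pdivrMr// mul1r ltrD2r x1/= => ->.
  by rewrite ler_pdivlMr// ltr_pdivrMr// lerBrDl ltrBlDl ![_ * (1 - p)]mulrC.
Qed.

Lemma measurable_digit_shift : measurable_fun setT digit_shift.
Proof.
apply: measurable_fun_if => //.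
- exact: measurable_fun_ltr.
- exact: measurable_funTS (measurable_funM _ _).
- by apply: measurable_funTS; apply: measurable_funM => //; exact: measurable_funB.
Qed.

Lemma measurable_digits_match s : measurable [set x | digits_match s x].
Proof.
elim: s => [|o s IH] /=; first by rewrite (_ : [set _ | _] = setT)//; apply/seteqP.
rewrite (_ : [set _ | _] =
  [set x | digit_fits o x] `&` digit_shift @^-1` [set x | digits_match s x]).
  apply: measurableI; last first.
    by rewrite -[X in measurable X]setTI; exact: measurable_digit_shift.
  have mlt : measurable [set x | x < p].
    by rewrite (_ : [set x | _] = `]-oo, p[%classic)//; apply/seteqP; split=> x /=;
      rewrite in_itv.
  case: o => [[]|] /=; last by rewrite (_ : [set _ | _] = setT)//; apply/seteqP.
    by rewrite (_ : [set x | _] = [set x | x < p])//; apply/seteqP; split=> x /=;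
      rewrite eqb_id.
  rewrite (_ : [set x | _] = ~` [set x | x < p]); first exact: measurableC.
  by apply/seteqP; split=> x /=; rewrite eqbF_neg => /negP.
by apply/seteqP; split => x /= => [/andP[]|[-> ->]].
Qed.

Local Notation U := (uniform_prob (@ltr01 R)).

Lemma pattern_weight_cat s t :
  pattern_weight (s ++ t) = pattern_weight s * pattern_weight t.
Proof. by rewrite /pattern_weight big_cat. Qed.

Lemma digits_match_cat s t x : digits_match (s ++ t) x =
  digits_match s x && digits_match t (iter (size s) digit_shift x).
Proof. by elim: s x => //= o s IH x; rewrite IH andbA -iterSr. Qed.

Lemma uniform_prob_digits_full (bs : seq bool) :
  U [set x | digits_match (map Some bs) x] =
  (pattern_weight (map Some bs))%:E.
Proof.
have [a [a0 w0 aw1 aE]] := digits_match_itv bs.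
have mI : measurable (`[0, 1[%classic : set R) by [].
have UI : U (`[0, 1[%classic : set R) = 1%E.
  by rewrite uniform_prob01_itv// subr0.
rewrite -(@probability_setI_full _ _ _ U _ _ mI (measurable_digits_match _) UI).
rewrite (_ : _ `&` _ = `[a, a + pattern_weight (map Some bs)[%classic).
  by apply: (etrans (uniform_prob01_itv _ _ _)); rewrite ?lerDl// addrC addKr.
apply/seteqP; split => x /=; rewrite !in_itv/= -aE; first by move=> [-> ->].
by move=> /andP[].
Qed.

(** A [None] is eliminated by splitting into the two values of the digit; the
    fully prescribed prefix [bs] makes the induction hypothesis apply to both. *)
Lemma uniform_prob_digits_cat (bs : seq bool) (s : seq (option bool)) :
  U [set x | digits_match (map Some bs ++ s) x] =
  (pattern_weight (map Some bs ++ s))%:E.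
Proof.
elim: s bs => [|o s IH] bs; first by rewrite cats0 uniform_prob_digits_full.
have next b : map Some bs ++ Some b :: s = map Some (rcons bs b) ++ s.
  by rewrite map_rcons cat_rcons.
case: o => [b|]; first by rewrite next IH.
rewrite (_ : [set x | _] =
  [set x | digits_match (map Some (rcons bs true) ++ s) x] `|`
  [set x | digits_match (map Some (rcons bs false) ++ s) x]).
  rewrite measureU; last 3 first.
  - exact: measurable_digits_match.
  - exact: measurable_digits_match.
  - rewrite -!next; apply/seteqP; split => x //= [].
    by rewrite !digits_match_cat /=; case: (_ < p); rewrite ?andbF.
  transitivity ((pattern_weight (map Some (rcons bs true) ++ s))%:E +
      (pattern_weight (map Some (rcons bs false) ++ s))%:E)%E.
    by congr (_ + _)%E; exact: IH.
  rewrite -!next -EFinD; congr (_%:E).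
  rewrite !pattern_weight_cat /pattern_weight !big_cons /=.
  by rewrite -mulrDr -mulrDl subrKC.
rewrite -!next; apply/seteqP; split => x /=; rewrite !digits_match_cat /=.
  by case: (_ < p); rewrite ?eqxx /= => h; [left|right].
by case: (_ < p); rewrite /= ?andbF => -[].
Qed.

Definition digit (x : R) (n : nat) : bool := iter n digit_shift x < p.

Lemma digits_match_nth (S : {fset nat}) n m x :
  digits_match [seq if i \in S then Some true else None | i <- iota n m]
    (iter n digit_shift x) =
  all (fun i => (i \in S) ==> digit x i) (iota n m).
Proof.
elim: m n => //= m IH n; rewrite -iterS IH; congr (_ && _).
by rewrite /digit; case: (n \in S); rewrite //= eqb_id.
Qed.

Lemma digit_bernoulli_field : bernoulli_field p U digit.
Proof.
have bnd (S : {fset nat}) : exists m, forall i, i \in S -> (i < m)%N.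
  by exists (\max_(i <- S) i).+1 => i iS; rewrite ltnS leq_bigmax_seq.
have E (S : {fset nat}) m : (forall i, i \in S -> (i < m)%N) ->
    [set x | forall j, j \in S -> digit x j] =
    [set x | digits_match [seq if i \in S then Some true else None
                          | i <- iota 0 m] x].
  move=> Sm; apply/seteqP; split => x; have := digits_match_nth S 0 m x;
    rewrite /mkset [iter 0 _ _]/= => ->.
    by move=> h; apply/allP => i _; apply/implyP; exact: h.
  move=> /allP h j jS; apply: (implyP (h j _)) => //.
  by rewrite mem_iota/= add0n Sm.
split=> [j|S].
  rewrite (_ : [set x | _] = [set x | forall i, i \in [fset j]%fset -> digit x i]).
    by have [m /E ->] := bnd [fset j]%fset; exact: measurable_digits_match.
  apply/seteqP; split=> x /=; last by apply; rewrite inE.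
  by move=> xj i; rewrite inE => /eqP ->.
have [m Sm] := bnd S.
rewrite (E S m Sm); apply: (etrans (uniform_prob_digits_cat [::] _)); congr (_%:E).
rewrite /= /pattern_weight big_map (eq_bigr (fun i => if i \in S then p else 1)).
  rewrite -big_mkcond big_const_seq -Monoid.iteropE/=; congr (_ ^+ _).
  rewrite -size_filter; apply: perm_size; apply: uniq_perm => //.
  - by rewrite filter_uniq// iota_uniq.
  - exact: fset_uniq.
  move=> i; rewrite mem_filter mem_iota /= add0n.
  by case: (boolP (i \in S)) => //= iS; rewrite Sm.
by move=> i _; case: ifP.
Qed.

End BernoulliDigits.

Lemma bernoulli_field_exists (R : realType) (p : R) (J : countType) :
  0 <= p <= 1 -> exists (d : measure_display) (T : measurableType d)
    (P : probability T R) (X : T -> J -> bool), bernoulli_field p P X.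
Proof.
move=> /andP[p0 p1]; exists _, _, (uniform_prob (@ltr01 R)).
exists (fun x => digit p x \o choice.pickle).
by apply: bernoulli_field_reindex (pcan_inj choice.pickleK) _; exact: digit_bernoulli_field.
Qed.

(** * Merging configurations along explored regions *)

(** Fatou's lemma for events: [F] is the increasing union of the events that
    [E n] holds from time [N] on. *)
Lemma probability_eventually_le d (T : measurableType d) (R : realType)
    (P : probability T R) (E : nat -> set T) (F : set T) (c : \bar R) :
  (forall n, measurable (E n)) ->
  (forall t, exists N, forall n, (N <= n)%N -> (E n t <-> F t)) ->
  (forall n, P (E n) <= c)%E -> measurable F /\ (P F <= c)%E.
Proof.
move=> mE EF Ec; pose D N := \bigcap_(n in [set n | (N <= n)%N]) E n.
have mD N : measurable (D N) by exact: bigcap_measurableType.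
have FD : F = \bigcup_N D N.
  apply/seteqP; split => t.
    by have [N h] := EF t => Ft; exists N => // n /= /h [_]; exact.
  have [N h] := EF t => -[M _ DM].
  by apply/(h (maxn N M)); [exact: leq_maxl|apply: DM; exact: leq_maxr].
have mF : measurable F by rewrite FD; exact: bigcupT_measurable.
split=> //; have cvgD : P \o D @ \oo --> P F.
  rewrite FD; apply: nondecreasing_cvg_mu => //; first by rewrite -FD.
  move=> m n mn; apply/subsetPset => t Dm k /= nk; apply: Dm.
  exact: leq_trans mn nk.
rewrite -(cvg_lim _ cvgD)//; apply: lime_le; first by apply/cvg_ex; exists (P F).
apply: nearW => N /=; apply: le_trans (Ec N); apply: le_measure; rewrite ?inE//.
by apply: bigcap_inf => /=.
Qed.

Lemma probability_eventually d (T : measurableType d) (R : realType)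
    (P : probability T R) (E : nat -> set T) (F : set T) (c : \bar R) :
  (forall n, measurable (E n)) ->
  (forall t, exists N, forall n, (N <= n)%N -> (E n t <-> F t)) ->
  (forall n, P (E n) = c) -> measurable F /\ P F = c.
Proof.
move=> mE EF Ec.
have [|mF Fc] := @probability_eventually_le _ _ _ P E F c mE EF.
  by move=> n; rewrite Ec.
split=> //; apply/eqP; rewrite eq_le Fc /=.
(* The reverse inequality is the same lemma for the complements. *)
have [|t|n|_] := @probability_eventually_le _ _ _ P (fun n => ~` E n) (~` F) (1 - c)%E.
- by move=> n; exact: measurableC.
- have [N h] := EF t; exists N => n /h [h1 h2].
  by split => h3 h4; apply: h3; [exact: h2|exact: h1].
- rewrite -(Ec n); have le_of_eq (a b : \bar R) : a = b -> (a <= b)%E by move=> ->.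
  exact: (le_of_eq _ _ (probability_setC P (mE n))).
rewrite [P (~` F)](probability_setC P mF).
have : P F \is a fin_num by exact: fin_num_measure.
have : c \is a fin_num by rewrite -(Ec 0%N); exact: fin_num_measure.
move: (P F) (c) => [f||] [e||]//= _ _.
by rewrite -!EFinB !lee_fin lerD2l lerN2.
Qed.

(** The successor of the first [k < n] with [Q k], and 0 if there is none: the
    value is directly the number of the layer to read, layer 0 being the spare
    configuration. *)
Fixpoint first_hit_below (Q : nat -> bool) (n : nat) : nat :=
  if n is m.+1 then
    (if first_hit_below Q m is k.+1 then k.+1 else if Q m then m.+1 else 0)%N
  else 0%N.

Lemma first_hit_belowS Q n : first_hit_below Q n.+1 =
  if first_hit_below Q n == 0%N then (if Q n then n.+1 else 0%N)
  else first_hit_below Q n.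
Proof. by rewrite /=; case: first_hit_below. Qed.

Lemma first_hit_below_le Q n : (first_hit_below Q n <= n)%N.
Proof.
elim: n => // n IH; rewrite first_hit_belowS; case: ifP => _; last exact: leqW.
by case: ifP.
Qed.

Lemma first_hit_below_ext Q Q' n : (forall k, (k < n)%N -> Q k = Q' k) ->
  first_hit_below Q n = first_hit_below Q' n.
Proof.
elim: n => //= n IH QQ'; rewrite IH ?QQ'// => k kn.
by apply: QQ'; exact: ltnW.
Qed.

Arguments first_hit_below : simpl never.

Lemma first_hit_below_stable Q m n : (m <= n)%N -> first_hit_below Q m != 0%N ->
  first_hit_below Q n = first_hit_below Q m.
Proof.
move=> mn Qm; elim: n mn => [|n IH]; first by rewrite leqn0 => /eqP ->.
rewrite leq_eqVlt => /orP[/eqP ->//|]; rewrite ltnS => /IH mn.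
by rewrite first_hit_belowS mn (negbTE Qm).
Qed.

Definition first_hit (Q : nat -> bool) : nat :=
  if pselect (exists n, first_hit_below Q n != 0%N) is left ex
  then first_hit_below Q (ex_minn ex) else 0%N.

Lemma first_hit_eventually Q :
  exists N, forall n, (N <= n)%N -> first_hit_below Q n = first_hit Q.
Proof.
rewrite /first_hit; case: pselect => [ex|nex].
  by case: ex_minnP => m Qm _; exists m => n mn; exact: first_hit_below_stable.
exists 0%N => n _; apply/eqP/negP => /negP h; by apply: nex; exists n.
Qed.

Lemma first_hit_least (Q : nat -> bool) k : Q k ->
  (forall i, (i < k)%N -> ~~ Q i) -> first_hit Q = k.+1.
Proof.
move=> Qk Qi; have Q0 : first_hit_below Q k = 0%N.
  elim: k Qi {Qk} => // k IH Qi; rewrite first_hit_belowS IH => [|i ik].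
    by rewrite (negbTE (Qi k _)).
  by apply: Qi; exact: ltnW.
have [N /(_ (maxn N k.+1) (leq_maxl _ _)) <-] := first_hit_eventually Q.
have Qk1 : first_hit_below Q k.+1 = k.+1 by rewrite first_hit_belowS Q0 eqxx Qk.
by rewrite (@first_hit_below_stable _ k.+1) ?leq_maxr// Qk1.
Qed.

(** [K k c] is the region explored in the configuration [c] of layer [k.+1].
    [Kstop] is the stopping property: the configuration inside the region
    determines the region. *)
Section Merge.
Context {R : realType} (p : R) {I : choiceType}
  (K : nat -> (I -> bool) -> set I).
Hypothesis mK : forall k s, measurable [set c : configs I | K k c s].
Hypothesis Kstop : forall k c c', (forall s, K k c s -> c s = c' s) ->
  K k c' = K k c.

Let J : choiceType := (nat * I)%type.
Implicit Types (x : J -> bool) (s : I).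

Definition layer x (k : nat) : I -> bool := fun s => x (k, s).

Definition claims x s (k : nat) : bool := `[< K k (layer x k.+1) s >].

Definition merge_below n x s : bool := x (first_hit_below (claims x s) n, s).

Definition merge x s : bool := x (first_hit (claims x s), s).

Lemma measurable_claims s k : measurable [set x : configs J | claims x s k].
Proof.
rewrite (_ : [set x | _] = (layer ^~ k.+1 : configs J -> configs I) @^-1`
    [set c : configs I | K k c s]).
  rewrite -[X in measurable X]setTI; apply: measurable_configs => // j.
  exact: measurable_site_open.
by apply/seteqP; split => x /asboolP.
Qed.

Lemma measurable_first_hit_below s n k :
  measurable [set x : configs J | first_hit_below (claims x s) n = k].
Proof.
elim: n k => [|n IH] k.
  exact: (@measurable_cst_prop _ (configs J) (0%N = k)).
rewrite (_ : [set x | _] =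
   ([set x : configs J | first_hit_below (claims x s) n = 0%N] `&`
      (([set x : configs J | claims x s n] `&` [set _ | n.+1 = k]) `|`
       (~` [set x : configs J | claims x s n] `&` [set _ | 0%N = k]))) `|`
   (~` [set x : configs J | first_hit_below (claims x s) n = 0%N] `&`
    [set x : configs J | first_hit_below (claims x s) n = k])).
  have mn := measurable_claims s n; have m0 := IH 0%N.
  apply: measurableU; apply: measurableI => //; last exact: measurableC.
  apply: measurableU; apply: measurableI; try exact: (@measurable_cst_prop _ (configs J)) => //.
    exact: mn.
  exact: measurableC.
apply/seteqP; split => x; rewrite /mkset first_hit_belowS.
  case: eqP => [f0|f0 <-]; last by right.
  by case: ifP => c <-; left; split => //; [left|right; split => //; apply/negP/negbT].
move=> [[-> [[-> //]|[/negP/negbTE -> //]]]|[/eqP/negbTE -> //]].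
Qed.

Lemma measurable_read (f : (J -> bool) -> nat) s :
  (forall k, measurable [set x : configs J | f x = k]) ->
  measurable [set x : configs J | x (f x, s)].
Proof.
move=> mf; rewrite (_ : [set x | _] =
    \bigcup_k ([set x : configs J | f x = k] `&` [set x : configs J | x (k, s)])).
  apply: bigcupT_measurable => k; apply: measurableI => //.
  exact: measurable_site_open.
by apply/seteqP; split => [x xf|x [k _ [/= -> //]]]; exists (f x).
Qed.

Lemma measurable_merge_below n s : measurable [set x : configs J | merge_below n x s].
Proof. by apply: measurable_read => k; exact: measurable_first_hit_below. Qed.

Definition swap (a b : J) (j : J) : J :=
  if j == a then b else if j == b then a else j.

Lemma swapK a b : involutive (swap a b).
Proof.
move=> j; rewrite /swap; have [->|ja] := eqVneq j a.
  by rewrite eqxx; case: eqVneq.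
have [->|jb] := eqVneq j b; first by rewrite eqxx.
by rewrite (negbTE ja) (negbTE jb).
Qed.

Lemma claims_below_ext x x' s n :
  (forall k, (0 < k <= n)%N -> layer x k = layer x' k) ->
  first_hit_below (claims x s) n = first_hit_below (claims x' s) n.
Proof. by move=> e; apply: first_hit_below_ext => k kn; rewrite /claims e. Qed.

(** If [s] is in none of the first regions, changing the state of [s] in layer
    [n.+1] is invisible to region [n] by the stopping property, and the earlier
    regions do not depend on that layer at all. *)
Lemma claims_swap x s n t : first_hit_below (claims x s) n.+1 = 0%N ->
  first_hit_below (claims (x \o swap (0%N, s) (n.+1, s)) t) n.+1 =
  first_hit_below (claims x t) n.+1.
Proof.
move=> xs; apply: first_hit_below_ext => k; rewrite ltnS => kn.
have sn : ~ K n (layer x n.+1) s.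
  move: xs; rewrite first_hit_belowS; case: eqP => [_|//]; case: ifP => // /negbT.
  by rewrite /claims => /asboolP.
rewrite /claims; congr (`[< _ >]).
move: kn; rewrite leq_eqVlt => /orP[/eqP ->|kn].
  rewrite (@Kstop n (layer x n.+1))// => s' Ks'.
  rewrite /layer /= /swap !xpair_eqE /= eqxx /=; case: (eqVneq s' s) => // e.
  by rewrite e in Ks'.
suff -> : layer (x \o swap (0%N, s) (n.+1, s)) k.+1 = layer x k.+1 by [].
apply/funext => s'; rewrite /layer /= /swap !xpair_eqE /= eqSS.
by rewrite (ltn_eqF kn).
Qed.

Definition layer_transposition n (j : J) : J :=
  (if j.1 == 0%N then n.+1 else if j.1 == n.+1 then 0%N else j.1, j.2).

Lemma layer_transpositionK n : involutive (layer_transposition n).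
Proof.
move=> [k i]; rewrite /layer_transposition /=.
have [->//|k0] := eqVneq k 0%N; first by rewrite /= eqxx.
by have [->//|k1] := eqVneq k n.+1; rewrite /= (negbTE k0) (negbTE k1).
Qed.

(** Interpolates between [merge_below n.+1] (all sites in [U]) and
    [merge_below n] with the roles of the layers 0 and [n.+1] exchanged (no site
    in [U]): in the latter, layer [n.+1] supplies the states both of region [n]
    and of the unclaimed sites. *)
Definition hybrid (U : seq I) n x s : bool :=
  let k := first_hit_below (claims x s) n.+1 in
  x (if k == 0%N then (if s \in U then 0%N else n.+1) else k, s).

Lemma measurable_hybrid U n s : measurable [set x : configs J | hybrid U n x s].
Proof.
apply: measurable_read => k.
rewrite (_ : [set x | _] =
  ([set x : configs J | first_hit_below (claims x s) n.+1 = 0%N] `&`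
     [set _ | (if s \in U then 0%N else n.+1) = k]) `|`
  (~` [set x : configs J | first_hit_below (claims x s) n.+1 = 0%N] `&`
     [set x : configs J | first_hit_below (claims x s) n.+1 = k])).
  have m0 := measurable_first_hit_below s n.+1 0; apply: measurableU.
    by apply: measurableI => //; exact: (@measurable_cst_prop _ (configs J)).
  by apply: measurableI; [exact: measurableC|exact: measurable_first_hit_below].
apply/seteqP; split => x /=; case: eqP => //=.
- by move=> ? ?; left.
- by move=> ? ?; right.
- by move=> ? [[]|[]].
- by move=> ? [[]|[]].
Qed.

Section MergeBernoulli.
Context d (T : measurableType d) (P : probability T R) (X : T -> J -> bool).
Hypothesis bX : bernoulli_field p P X.

(** The permuted field is again a Bernoulli field, and its law is determined by
    [p] alone. *)
Lemma bernoulli_field_involution (f : J -> J) (B : set (configs J)) :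
  involutive f -> measurable B ->
  P [set t | B (X t \o f)] = P [set t | B (X t)].
Proof.
move=> fK mB; exact: (bernoulli_field_law (bernoulli_field_reindex (inv_inj fK) bX) bX mB).
Qed.

Lemma measurable_along (B : set (configs J)) : measurable B ->
  measurable [set t | B (X t)].
Proof.
move=> mB; rewrite -[X in measurable X]setTI.
by apply: (@measurable_configs _ _ _ (X : T -> configs J)) => // j; case: bX => + _.
Qed.

Lemma measurable_all_sites (g : (J -> bool) -> I -> bool) (S : {fset I}) :
  (forall s, measurable [set x : configs J | g x s]) ->
  measurable [set x : configs J | forall s, s \in S -> g x s].
Proof.
by move=> mg; apply: (@measurable_fset_forall _ _ _ S
  (fun s => [set x : configs J | g x s])).
Qed.

(** Adding [s] to [U] only matters when [s] is unclaimed.  On that event it has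
    the effect of exchanging the states of [s] in the layers 0 and [n.+1], and
    by [claims_swap] neither the event nor the choice of the layers to read is
    affected by the exchange. *)
Lemma probability_hybrid_cons (S : {fset I}) n (U : seq I) (s : I) :
  P [set t | forall i, i \in S -> hybrid (s :: U) n (X t) i] =
  P [set t | forall i, i \in S -> hybrid U n (X t) i].
Proof.
have [sU|sU] := boolP (s \in U).
  congr (P _); apply/seteqP; split => t /= h i /h; rewrite /hybrid inE;
    by case: (eqVneq i s) => // ->; rewrite sU.
pose H V := [set x : configs J | forall i, i \in S -> hybrid V n x i].
pose A := [set x : configs J | first_hit_below (claims x s) n.+1 = 0%N].
have mH V : measurable (H V).
  by apply: measurable_all_sites => i; exact: measurable_hybrid.
have mA : measurable A by exact: measurable_first_hit_below.
have split_A V : P [set t | H V (X t)] =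
    (P [set t | (H V `\` A) (X t)] + P [set t | (H V `&` A) (X t)])%E.
  apply: (measureDI P (A := [set t | H V (X t)]) (B := [set t | A (X t)]));
  exact: measurable_along.
rewrite -!/(H _ _) in split_A *.
rewrite [LHS]split_A [RHS]split_A; congr (_ + _)%E.
  congr (P _); apply/seteqP; split => t /= [h hA]; split => // i /h;
    rewrite /hybrid inE; case: (eqVneq i s) => // ->;
    by have /eqP/negbTE -> := hA.
rewrite -[RHS](@bernoulli_field_involution (swap (0%N, s) (n.+1, s))); last 2 first.
- exact: swapK.
- exact: measurableI.
have AA x : A x -> A (x \o swap (0%N, s) (n.+1, s)).
  by move=> Ax; rewrite /A /mkset claims_swap.
have HH x i : A x -> hybrid (s :: U) n x i =
    hybrid U n (x \o swap (0%N, s) (n.+1, s)) i.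
  move=> Ax; rewrite /hybrid claims_swap//= /swap !xpair_eqE inE.
  have [->|is_] := eqVneq i s; last by rewrite /= !andbF.
  by rewrite Ax /= (negbTE sU) eqxx.
congr (P _); apply/seteqP; split => t /= [h hA]; split.
- by move=> i /h; rewrite HH.
- exact: AA.
- have hA' : A (X t).
    rewrite (_ : X t = (X t \o swap (0%N, s) (n.+1, s)) \o
                        swap (0%N, s) (n.+1, s)); first exact: AA.
    by apply/funext => j /=; rewrite swapK.
  by move=> i /h; rewrite HH.
- rewrite (_ : X t = (X t \o swap (0%N, s) (n.+1, s)) \o
                        swap (0%N, s) (n.+1, s)); first exact: AA.
  by apply/funext => j /=; rewrite swapK.
Qed.

Lemma hybrid_nilE n x i : hybrid [::] n x i =
  merge_below n (x \o layer_transposition n) i.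
Proof.
have lE k : (0 < k <= n)%N -> layer (x \o layer_transposition n) k = layer x k.
  move=> /andP[k0 kn]; apply/funext => s.
  by rewrite /layer /layer_transposition /= gtn_eqF// ltn_eqF.
rewrite /merge_below (claims_below_ext _ lE) /hybrid first_hit_belowS /=.
rewrite /layer_transposition /=; have := first_hit_below_le (claims x i) n.
case: (first_hit_below _ n) => [|k] kn /=; first by case: (claims x i n).
by rewrite eqSS ltn_eqF.
Qed.

Lemma probability_merge_below (S : {fset I}) n :
  P [set t | forall i, i \in S -> merge_below n (X t) i] = (p ^+ #|` S|)%:E.
Proof.
elim: n => [|n IH].
  have pair_inj : injective (pair 0%N : I -> J) by move=> i j [].
  by have [_ PX0] := bernoulli_field_reindex pair_inj bX; exact: PX0.
rewrite (_ : [set t | _] = [set t | forall i, i \in S -> hybrid S n (X t) i]).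
  have -> (U : seq I) : P [set t | forall i, i \in S -> hybrid U n (X t) i] =
      P [set t | forall i, i \in S -> hybrid [::] n (X t) i].
    by elim: U => // s U <-; exact: probability_hybrid_cons.
  rewrite -IH -[RHS](@bernoulli_field_involution (layer_transposition n)
    [set x : configs J | forall i, i \in S -> merge_below n x i]); last 2 first.
  - exact: layer_transpositionK.
  - by apply: measurable_all_sites => i; exact: measurable_merge_below.
  by congr (P _); apply/seteqP; split => t /= h i /h; rewrite hybrid_nilE.
by apply/seteqP; split => t /= h i iS; have := h i iS;
  rewrite /hybrid /merge_below iS; case: eqP => // ->.
Qed.

(** At each site [merge_below n] is eventually equal to [merge], so the limit
    inherits the constant probabilities of [probability_merge_below]. *)
Lemma bernoulli_field_merge : bernoulli_field p P (fun t => merge (X t)).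
Proof.
have lim (S : {fset I}) : measurable [set t | forall i, i \in S -> merge (X t) i] /\
    P [set t | forall i, i \in S -> merge (X t) i] = (p ^+ #|` S|)%:E.
  apply: (@probability_eventually _ _ _ P
    (fun n => [set t | forall i, i \in S -> merge_below n (X t) i])).
  - move=> n; apply: (@measurable_along
      [set x : configs J | forall i, i \in S -> merge_below n x i]).
    by apply: measurable_all_sites => i; exact: measurable_merge_below.
  - move=> t; suff [N NE] : exists N, forall n, (N <= n)%N ->
        forall i, i \in S -> merge_below n (X t) i = merge (X t) i.
      by exists N => n /NE e; split => h i iS; move: (h i iS); rewrite e.
    have [N NE] := choice (fun i => first_hit_eventually (claims (X t) i)).
    exists (\max_(i <- S) N i) => n Nn i iS.
    by rewrite /merge_below NE// (leq_trans _ Nn)// leq_bigmax_seq.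
  - by move=> n; exact: probability_merge_below.
split=> [j|S]; last by case: (lim S).
rewrite (_ : [set t | _] =
    [set t | forall i, i \in [fset j]%fset -> merge (X t) i]).
  by case: (lim [fset j]%fset).
apply/seteqP; split=> t /=; last by apply; rewrite inE.
by move=> tj i; rewrite inE => /eqP ->.
Qed.

End MergeBernoulli.
End Merge.

(** * Lipschitz covers and admissible paths *)

Section Covers.
Context {n : nat}.
Local Notation V := 'rV[int]_n.
Implicit Types (c : V * nat -> bool) (Y : set V) (f g : V -> nat).

Lemma l1normN (x : V) : l1norm (- x) = l1norm x.
Proof. by rewrite /l1norm; apply: eq_bigr => i _; rewrite mxE abszN. Qed.

Lemma lipschitzP f : Defs.lipschitz f <->
  forall x y : V, l1norm (x - y) = 1%N -> (f x <= (f y).+1)%N.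
Proof.
split=> lf x y xy; first by have := lf x y xy; lia.
have := lf x y xy; have := lf y x; rewrite -opprB l1normN => /(_ xy); lia.
Qed.

Lemma lipschitz_l1norm f (x y : V) : Defs.lipschitz f ->
  (f x <= f y + l1norm (x - y))%N.
Proof.
move=> /lipschitzP lf; move Ek : (l1norm (x - y)) => k.
elim: k x Ek => [|k IH] x xy.
  suff -> : x = y by rewrite addn0.
  apply/eqP; rewrite -subr_eq0; apply/eqP/rowP => i; rewrite [RHS]mxE.
  apply/eqP; rewrite -absz_eq0; move/eqP: xy; rewrite sum_nat_eq0.
  by move=> /forallP/(_ i); rewrite (ord1 ord0).
have [i wi0] : exists i, (x - y) ord0 i != 0.
  apply/existsP; rewrite -negb_forall; apply/negP => /forallP w0.
  move: xy; rewrite /l1norm big1// => i _.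
  by move: (w0 i) => /eqP ->.
(* One unit step from [x] towards [y] along a coordinate where they differ. *)
pose e : V := \row_j (if j == i then
    (if 0 <= (x - y) ord0 i then 1 else -1) else 0).
have e1 : l1norm (x - (x - e)) = 1%N.
  rewrite opprB addrC subrK /l1norm (bigD1 i)//= big1 => [|j ji].
    by rewrite !mxE eqxx; case: ifP.
  by rewrite mxE (negbTE ji).
have -> : (f y + k.+1 = (f y + k).+1)%N by lia.
apply: leq_trans (lf _ _ e1) _; rewrite ltnS; apply: IH.
move: xy; rewrite /l1norm (bigD1 i)//= [in X in _ -> X](bigD1 i)//=.
have -> : (\sum_(j < n | j != i) `|((x - e - y) ord0 j)%R| =
           \sum_(j < n | j != i) `|((x - y) ord0 j)%R|)%N.
  by apply: eq_bigr => j ji; rewrite !mxE (negbTE ji) subr0.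
have step (a b : int) (r : nat) : a - b != 0 ->
    (`|(a - b)%R| + r = k.+1 ->
     `|(a - (if 0 <= a - b then 1 else -1) - b)%R| + r = k)%N.
  by case: ifP; lia.
by move: wi0; rewrite !mxE eqxx; exact: step.
Qed.

(** The local cover at [y] is the minimum of this class for [Y = [set y]], and
    the lowest open Lipschitz function its minimum for [Y = setT]. *)
Definition cover_family c Y : set (V -> nat) :=
  [set f | [/\ Defs.lipschitz f, forall y, Y y -> (0 < f y)%N &
               forall x, f x = 0%N \/ c (x, f x)]].

(** Paths from the points of [Y] at height 0 that go up one unit when the site
    they arrive at is closed, and go down one unit while staying in the column
    or moving to a neighbouring one.  A function of the class must pass strictly
    above every point of such a path. *)
Fixpoint reach_in c Y (k : nat) : V -> nat -> Prop :=
  match k with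
  | 0 => fun x m => Y x /\ m = 0%N
  | k'.+1 => fun x m =>
      (exists2 m', m = m'.+1 & ~~ c (x, m) /\ reach_in c Y k' x m') \/
      (exists x', (x' = x \/ l1norm (x' - x) = 1%N) /\ reach_in c Y k' x' m.+1)
  end.

Definition reached c Y x m : Prop := exists k, reach_in c Y k x m.

Lemma reach_in_below c Y f k x m :
  cover_family c Y f -> reach_in c Y k x m -> (m < f x)%N.
Proof.
move=> [/lipschitzP lf Yf fc]; elim: k x m => [|k IH] x m /=.
  by move=> [/Yf fx ->].
move=> [[m' -> [ncx /IH m'x]]|[x' [xx' /IH mx']]].
  rewrite ltn_neqAle m'x andbT; apply: contra ncx => /eqP ->.
  by case: (fc x) m'x => [->|].
by case: xx' mx' => [->|/lf]; lia.
Qed.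

Lemma reached_pred c Y x m : reached c Y x m.+1 -> reached c Y x m.
Proof. by move=> [k h]; exists k.+1; right; exists x; split; [left|]. Qed.

(** The heights of the reached points define the least function of the class:
    downward steps make it Lipschitz, and if the site on the graph were closed
    then an upward step would reach it. *)
Lemma cover_of_reached c Y : (forall x, exists m, ~ reached c Y x m) ->
  exists2 f, cover_family c Y f & forall x m, (m < f x)%N <-> reached c Y x m.
Proof.
move=> fin; have ex x : exists m, ~~ `[< reached c Y x m >].
  by have [m h] := fin x; exists m; apply/asboolP.
pose f x := ex_minn (ex x).
have fP x m : (m < f x)%N <-> reached c Y x m.
  rewrite /f; case: ex_minnP => k /asboolP nk kmin; split.
    by move=> mk; apply: contrapT => /asboolPn /kmin; rewrite leqNgt mk.
  move=> rm; rewrite ltnNge; apply/negP => km; apply: nk.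
  move: rm; rewrite -(subnK km); elim: (m - k)%N => // i IH /reached_pred.
  exact: IH.
exists f => //; split.
- apply/lipschitzP => x y xy; case fx : (f x) => [|[|k]]//.
  have /fP [i ri] : (k.+1 < f x)%N by rewrite fx.
  by rewrite ltnS; apply/fP; exists i.+1; right; exists x; split; [right|].
- by move=> y Yy; apply/fP; exists 0%N.
- move=> x; case fx : (f x) => [|k]; [by left|right].
  apply: contrapT => /negP ncx; have /fP [i ri] : (k < f x)%N by rewrite fx.
  have : (k.+1 < f x)%N by apply/fP; exists i.+1; left; exists k.
  by rewrite fx ltnn.
Qed.

Lemma least_cover c Y f0 : cover_family c Y f0 ->
  exists2 f, cover_family c Y f &
    forall g, cover_family c Y g -> forall x, (f x <= g x)%N.
Proof.
move=> C0; have [|f Cf fP] := @cover_of_reached c Y.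
  by move=> x; exists (f0 x) => -[k /(reach_in_below C0)]; rewrite ltnn.
exists f => // g Cg x; rewrite leqNgt; apply/negP => /fP[k].
by move/(reach_in_below Cg); rewrite ltnn.
Qed.

(** True of every [x] and [m] when the class is empty, in accordance with the
    convention that the minimum is then infinite. *)
Definition cover_above c Y x m : Prop :=
  forall f, cover_family c Y f -> (m < f x)%N.

(** The second alternative is the case of an empty class: there is no function
    in the class if and only if some column is reached at all heights. *)
Lemma cover_aboveE c Y x m : cover_above c Y x m <->
  (reached c Y x m \/ exists x', forall k, reached c Y x' k).
Proof.
split=> [above|[[k r] f Cf|[x' r] f Cf]]; last 2 first.
- exact: reach_in_below Cf r.
- by have [k /(reach_in_below Cf)] := r (f x'); rewrite ltnn.
have [inf|fin] := pselect (exists x', forall k, reached c Y x' k); [by right|left].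
have [|f Cf fP] := @cover_of_reached c Y; last by apply/fP; exact: above.
move=> x'; apply: contrapT => h; apply: fin; exists x' => k.
by apply: contrapT => rk; apply: h; exists k.
Qed.

Lemma cover_family_min c Y f g : cover_family c Y f -> cover_family c Y g ->
  cover_family c Y (fun x => minn (f x) (g x)).
Proof.
move=> [/lipschitzP lf fY fc] [/lipschitzP lg gY gc]; split.
- by apply/lipschitzP => x y xy; have := lf x y xy; have := lg x y xy; lia.
- by move=> y Yy; rewrite leq_min fY// gY.
- by move=> x; rewrite /minn; case: ifP.
Qed.

Lemma cover_family_transfer c c' Y f :
  (forall x, (0 < f x)%N -> c (x, f x) = c' (x, f x)) ->
  cover_family c Y f -> cover_family c' Y f.
Proof.
move=> cc' [lf fY fc]; split => // x; case: (posnP (f x)) => [|f0]; [by left|].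
by right; rewrite -cc'//; case: (fc x) f0 => [->|].
Qed.

(** The sites of positive height on or below the graph of the minimum. *)
Definition explored c Y : set (V * nat) :=
  [set s | (0 < s.2)%N /\ cover_above c Y s.1 s.2.-1].

(** Let [f] be the least function of the class of [c].  It lies in the class of
    [c'], because the two configurations agree on its graph.  Conversely the
    minimum of [f] and a function of the class of [c'] runs inside the explored
    region, so it lies in the class of [c]; hence both classes have the same
    minimum.  If the class of [c] is empty, all sites of positive height are
    explored and the two classes are equal. *)
Lemma explored_stopping c c' Y : (forall s, explored c Y s -> c s = c' s) ->
  explored c' Y = explored c Y.
Proof.
move=> cc'; suff aboveE x m : cover_above c' Y x m <-> cover_above c Y x m.
  by apply/seteqP; split=> -[x h] /= [h0 /aboveE].
have [[f0 /least_cover[f Cf fmin]]|C0] := pselect (exists f, cover_family c Y f).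
  have below g : (forall z, (g z <= f z)%N) ->
      forall z, (0 < g z)%N -> c (z, g z) = c' (z, g z).
    move=> gf z gz; apply: cc'; split => //= k Ck.
    by rewrite prednK//; apply: leq_trans (gf z) (fmin _ Ck z).
  have C'f : cover_family c' Y f.
    by apply: cover_family_transfer Cf; exact: below.
  split=> above g Cg; last first.
    have Cm : cover_family c Y (fun z => minn (f z) (g z)).
      apply: (@cover_family_transfer c'); last exact: cover_family_min.
      by move=> z z0; apply/esym; apply: (below (fun u => minn (f u) (g u))) z0 => u;
        exact: geq_minl.
    by apply: leq_trans (above _ Cm) _; exact: geq_minr.
  exact: leq_trans (above _ C'f) (fmin _ Cg x).
have C0c g : ~ cover_family c Y g by move=> Cg; apply: C0; exists g.
have C0c' g : ~ cover_family c' Y g.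
  move=> Cg; apply: (C0c g); apply: cover_family_transfer Cg => z gz.
  by apply/esym; apply: cc'; split => // k /C0c.
by split=> _ g; [move/C0c|move/C0c'].
Qed.

Lemma measurable_reach_in Y k x m :
  measurable [set c : configs (V * nat)%type | reach_in c Y k x m].
Proof.
elim: k x m => [|k IH] x m /=; first exact: (@measurable_cst_prop _ (configs (V * nat)%type)).
apply: measurableU.
  case: m => [|m].
    rewrite [X in measurable X](_ : _ = set0)//.
    by apply/seteqP; split => // c [].
  rewrite [X in measurable X](_ : _ =
    ~` [set c : configs (V * nat)%type | c (x, m.+1)] `&`
    [set c : configs (V * nat)%type | reach_in c Y k x m]).
    by apply: measurableI => //; apply: measurableC; exact: measurable_site_open.
  apply/seteqP; split => c /=.
    by move=> [m' [<-] [/negP]].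
  by move=> [/negP h r]; exists m.
rewrite [X in measurable X](_ : _ = \bigcup_x'
   ([set _ | x' = x \/ l1norm (x' - x) = 1%N] `&`
    [set c : configs (V * nat)%type | reach_in c Y k x' m.+1])).
  apply: countable_bigcupT_measurable => // x'; apply: measurableI => //.
  exact: (@measurable_cst_prop _ (configs (V * nat)%type)).
apply/seteqP; split => c /= [x']; last by move=> _ xx'; exists x'.
by move=> xx'; exists x'.
Qed.

Lemma measurable_reached Y x m :
  measurable [set c : configs (V * nat)%type | reached c Y x m].
Proof.
rewrite (_ : [set _ | _] =
  \bigcup_k [set c : configs (V * nat)%type | reach_in c Y k x m]).
  by apply: bigcupT_measurable => k; exact: measurable_reach_in.
by apply/seteqP; split => c /= [k]; exists k.
Qed.

Lemma measurable_cover_above Y x m :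
  measurable [set c : configs (V * nat)%type | cover_above c Y x m].
Proof.
rewrite (_ : [set _ | _] =
  [set c : configs (V * nat)%type | reached c Y x m] `|`
  \bigcup_(x' in setT) \bigcap_k [set c : configs (V * nat)%type | reached c Y x' k]).
  apply: measurableU; first exact: measurable_reached.
  apply: countable_bigcupT_measurable => // x'; apply: bigcapT_measurable => k.
  exact: measurable_reached.
apply/seteqP; split => c /=.
  move=> /cover_aboveE[r|[x' r]]; [by left|right].
  by exists x' => // k _; exact: r.
by move=> h; apply/cover_aboveE; case: h => [|[x' _ r]]; [left|right; exists x' => k; exact: r].
Qed.

Lemma measurable_explored Y s :
  measurable [set c : configs (V * nat)%type | explored c Y s].
Proof.
by apply: measurableI; [exact: (@measurable_cst_prop _ (configs (V * nat)%type))|exact: measurable_cover_above].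
Qed.

End Covers.

(** * Cover heights as random functions *)

Lemma measurable_heights (R : realType) (n : nat) d (T : measurableType d)
    (X : T -> heights R n) :
  (forall x, measurable_fun setT (fun t => X t x)) -> measurable_fun setT X.
Proof.
move=> mX; apply: (@measurability _ _ T (heights R n) setT X (@cylinders R n) erefl).
move=> _ [_ [x [C [mC ->]]] <-]; exact: mX.
Qed.

Lemma measurable_height (R : realType) (n : nat) (x : 'rV[int]_n) :
  measurable_fun setT (fun a : heights R n => a x).
Proof.
move=> _ C mC; rewrite setTI; apply: sub_sigma_algebra; by exists x, C.
Qed.

Section CoverHeights.
Context {R : realType} {n : nat}.
Local Notation V := 'rV[int]_n.
Implicit Types (c : V * nat -> bool) (Y : set V).

Definition cover_height c Y : V -> \bar R := pointwise_min R (cover_family c Y).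

Lemma cover_height_cases c Y :
  (cover_height c Y = (fun=> +oo%E) /\ forall x m, cover_above c Y x m) \/
  exists f, [/\ cover_family c Y f, cover_height c Y = (fun x => ((f x)%:R)%:E) &
    forall x m, cover_above c Y x m <-> (m < f x)%N].
Proof.
have [[f0 /least_cover[f Cf fmin]]|C0] := pselect (exists f, cover_family c Y f).
  right; exists f; split=> //.
    apply/funext => x; apply/eqP; rewrite eq_le; apply/andP; split.
      by apply: ereal_inf_lbound; exists f.
    by apply: le_ereal_inf_tmp => _ [g Cg <-]; rewrite lee_fin ler_nat fmin.
  move=> x m; split=> [above|mf g Cg]; first exact: above.
  exact: leq_trans mf (fmin _ Cg x).
left; split=> [|x m f Cf]; last by exfalso; apply: C0; exists f.
apply/funext => x; rewrite /cover_height (_ : cover_family c Y = set0).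
  exact: pointwise_min0.
by apply/seteqP; split=> // f Cf; apply: C0; exists f.
Qed.

Lemma cover_height_natE c Y x m : cover_height c Y x = (m%:R)%:E <->
  forall k, cover_above c Y x k <-> (k < m)%N.
Proof.
case: (cover_height_cases c Y) => [[-> above]|[f [_ -> fP]]].
  by split=> // h; have /h := above x m; rewrite ltnn.
split=> [[/eqP]|h].
  by rewrite eqr_nat => /eqP <- k; exact: fP.
suff -> : f x = m by [].
case: (ltngtP (f x) m) => //.
  by move=> /(proj2 (h (f x)))/(proj1 (fP x (f x))); rewrite ltnn.
by move=> /(proj2 (fP x m))/(proj1 (h m)); rewrite ltnn.
Qed.

Lemma cover_height_pinftyE c Y x : cover_height c Y x = +oo%E <->
  forall k, cover_above c Y x k.
Proof.
case: (cover_height_cases c Y) => [[-> above]|[f [_ -> fP]]]; first by split.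
by split=> // /(_ (f x))/fP; rewrite ltnn.
Qed.

(** The values are natural numbers or infinity, and each value is characterised
    by countably many of the events [cover_above]. *)
Lemma measurable_cover_height Y :
  measurable_fun [set: configs (V * nat)%type]
    (fun c => cover_height c Y : heights R n).
Proof.
apply: measurable_heights => x _ B mB; rewrite setTI.
pose U k := [set c : configs (V * nat)%type | cover_above c Y x k].
have mU k : measurable (U k) by exact: measurable_cover_above.
pose E m := \bigcap_k (if (k < m)%N then U k else ~` U k).
have mE m : measurable (E m).
  by apply: bigcapT_measurable => k; case: ifP => _; [|apply: measurableC].
have mcst (Z : Prop) : measurable [set _ : configs (V * nat)%type | Z].
  exact: measurable_cst_prop.
rewrite [X in measurable X](_ : _ = (\bigcup_m (E m `&` [set _ | B (m%:R)%:E])) `|`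
  (\bigcap_k U k `&` [set _ | B +oo%E])).
  apply: measurableU.
    by apply: bigcupT_measurable => m; exact: measurableI.
  by apply: measurableI => //; exact: bigcapT_measurable.
have EE m c : E m c <-> cover_height c Y x = (m%:R)%:E.
  split=> [h|/cover_height_natE h].
    apply/cover_height_natE => k; have := h k I; rewrite /U.
    by case: ifP => _ /=; split.
  by move=> k _; have := h k; rewrite /U; case: ifP => _ /= [h1 h2];
    [exact: h2|move=> /h1].
apply/seteqP; split => c /=.
  move=> Bc; case: (cover_height_cases c Y) => [[h above]|[f [_ h _]]].
    by right; split; [move=> k _; exact: above|move: Bc; rewrite /= h].
  by left; exists (f x) => //; split; [apply/EE; rewrite h|move: Bc; rewrite /= h].
move=> [[m _ [/EE /= -> //]]|[h Bh]].
by have /cover_height_pinftyE -> : forall k, cover_above c Y x k by move=> k; exact: h.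
Qed.

End CoverHeights.

Lemma measurable_sup_heights (R : realType) (n : nat) (L : countType) d
    (T : measurableType d) (X : T -> L -> heights R n) :
  (forall y, measurable_fun setT (X ^~ y)) ->
  measurable_fun setT
    ((fun t x => ereal_sup [set X t y x | y in setT]) : T -> heights R n).
Proof.
move=> mX; apply: measurable_heights => x.
apply: (measurability _ (ErealGenOInfty.measurableE R)).
move=> _ [_ [r ->] <-]; rewrite setTI.
rewrite [X in measurable X](_ : _ = \bigcup_y [set t | (r%:E < X t y x)%E]).
  apply: countable_bigcupT_measurable => // y.
  have mXyx : measurable_fun setT (fun t => X t y x).
    by apply: measurableT_comp (@measurable_height R n x) (mX y).
  have := mXyx measurableT _ (emeasurable_itv `]r%:E, +oo[).
  rewrite setTI [X in measurable X -> _](_ : _ = [set t | (r%:E < X t y x)%E]) //.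
  by apply/seteqP; split=> t /=; rewrite in_itv /= andbT.
apply/seteqP; split=> t /=; rewrite in_itv /= andbT.
  by move=> /ereal_sup_gt[_ [y _ <-] ry]; exists y.
move=> [y _ /= ry]; apply: lt_le_trans ry _.
by apply: ereal_sup_ubound; exists y.
Qed.

(** A pi-system that generates the product sigma-algebra. *)
Definition family_cylinders (L : choiceType) d (T : measurableType d) :
    set (set (L -> T)) :=
  [set B | exists (J : {fset L}) (C : L -> set T), (forall y, measurable (C y)) /\
     B = [set a : L -> T | forall y, y \in J -> C y (a y)]].

Lemma family_law (R : realType) (L : choiceType)
    d1 (T1 : measurableType d1) (P1 : probability T1 R)
    d2 (T2 : measurableType d2) (P2 : probability T2 R)
    d (T : measurableType d) (X1 : T1 -> L -> T) (X2 : T2 -> L -> T) :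
  (forall y, measurable_fun setT (X1 ^~ y)) ->
  (forall y, measurable_fun setT (X2 ^~ y)) ->
  (forall (J : {fset L}) (C : L -> set T), (forall y, measurable (C y)) ->
    P1 [set t | forall y, y \in J -> C y (X1 t y)] =
    P2 [set t | forall y, y \in J -> C y (X2 t y)]) ->
  forall B : set (L -> T), <<s @family_cylinders L d T >> B ->
  P1 [set t | B (X1 t)] = P2 [set t | B (X2 t)].
Proof.
move=> mX1 mX2 X12 B sB.
have mcyl d' (T' : measurableType d') (X : T' -> L -> T) (J : {fset L}) C :
    (forall y, measurable_fun setT (X ^~ y)) -> (forall y, measurable (C y)) ->
    measurable [set t | forall y, y \in J -> C y (X t y)].
  move=> mX mC; apply: (@measurable_fset_forall _ _ _ J (fun y => [set t | C y (X t y)])).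
  by move=> y; have := mX y measurableT _ (mC y); rewrite setTI.
have [||||_ _ //] := @pi_law_unique _ _ R _ _ P1 P2 _ X1 X2
  (@family_cylinders L d T) _ _ _ _ B sB.
- move=> _ _ [J [C [mC ->]]] [J' [C' [mC' ->]]]; exists (J `|` J')%fset.
  exists (fun y => [set a | (y \in J -> C y a) /\ (y \in J' -> C' y a)]).
  split=> [y|].
    case: (boolP (y \in J)) (boolP (y \in J')) => [yJ|yJ] [yJ'|yJ'].
    + rewrite [X in measurable X](_ : _ = C y `&` C' y); first exact: measurableI.
      by apply/seteqP; split=> a /= [h h']; split; auto.
    + rewrite [X in measurable X](_ : _ = C y); first exact: mC.
      by apply/seteqP; split=> a /= h; [apply h.1|split].
    + rewrite [X in measurable X](_ : _ = C' y); first exact: mC'.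
      by apply/seteqP; split=> a /= h; [apply h.2|split].
    + rewrite [X in measurable X](_ : _ = setT); first exact: measurableT.
      by apply/seteqP; split.
  apply/seteqP; split=> a /=.
    by move=> [h h'] y _; split; [exact: h|exact: h'].
  by move=> h; split=> y yJ; apply (h y); rewrite // inE yJ ?orbT.
- by apply: le_lt_trans (ltry 1); rewrite -(probability_setT P1).
- exact: (etrans (probability_setT P1) (esym (probability_setT P2))).
- move=> _ [J [C [mC ->]]]; split; [exact: mcyl|exact: mcyl|exact: X12].
Qed.

Section LayersIndependent.
Context {R : realType} {p : R} {L I : choiceType} d (T : measurableType d)
  (P : probability T R) (X : T -> L * I -> bool).
Hypothesis bX : bernoulli_field p P X.

Let lay t (y : L) : configs I := fun s => X t (y, s).

Lemma layers_independent (J : {fset L}) (C : L -> set (configs I)) :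
  (forall y, measurable (C y)) ->
  P [set t | forall y, y \in J -> C y (lay t y)] =
  (\prod_(y <- J) P [set t | C y (lay t y)])%E.
Proof.
move=> mC.
have mlay y B : measurable B -> measurable [set t | B (lay t y)].
  move=> mB; rewrite -[X in measurable X]setTI.
  apply: (@measurable_configs _ _ _ (lay ^~ y)) => // s.
  exact: (proj1 bX (y, s)).
pose E (l : seq L) (S : {fset L * I}) :=
  [set t | (forall y, y \in l -> C y (lay t y)) /\ forall s, s \in S -> X t s].
have mE l S : measurable (E l S).
  apply: measurableI; last first.
    by apply: (@measurable_fset_forall _ _ _ S (fun s => [set t | X t s])) => s;
      exact: (proj1 bX s).
  rewrite [X in measurable X](_ : _ =
      [set t | forall y, y \in [fset y in l]%fset -> C y (lay t y)]).
    apply: (@measurable_fset_forall _ _ _ _ (fun y => [set t | C y (lay t y)])) => y.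
    exact: mlay.
  by apply/seteqP; split=> t /= h y yl; apply: h; move: yl; rewrite inE.
(* Finitely many blocks together with finitely many sites outside them: the
   sites make the induction on the number of blocks work, since on the
   generating events the next block turns into such sites. *)
have main (l : seq L) (S : {fset L * I}) : uniq l ->
    (forall s, s \in S -> s.1 \notin l) ->
    P (E l S) = ((\prod_(y <- l) P [set t | C y (lay t y)]) * (p ^+ #|` S|)%:E)%E.
  elim: l S => [|y l IH] S /=.
    move=> _ _; rewrite big_nil mul1e -(proj2 bX); congr (P _).
    by apply/seteqP; split=> t /= => [[]|h].
  move=> /andP[yl ul] Sl.
  have Sl' s : s \in S -> s.1 \notin l.
    by move=> /Sl; rewrite inE negb_or => /andP[].
  have c0 : 0 <= fine (P (E l S)) by rewrite fine_ge0.
  (* As functions of the event about block [y], both sides of the claim are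
     finite measures, so they need only be compared on the generating events. *)
  pose m1 := mrestr P (mE l S).
  pose m2 := mscale (NngNum c0) P.
  have fE : (fine (P (E l S)))%:E = P (E l S).
    by rewrite fineK// fin_num_measure.
  have m1E B : m1 ((lay ^~ y) @^-1` B) = P ([set t | B (lay t y)] `&` E l S) by [].
  have m2E B : m2 ((lay ^~ y) @^-1` B) = (P (E l S) * P [set t | B (lay t y)])%E.
    by rewrite /m2 /mscale /= fE.
  have [||||_ _ m12] := @pi_law_unique _ _ R _ _ m1 m2 _ (lay ^~ y) (lay ^~ y)
    (@open_cylinders I) _ _ _ _ (C y) (mC y).
  - exact: open_cylinders_setI.
  - rewrite /m1 /= /mrestr setTI -fE; exact: ltry.
  - rewrite /m1 /m2 /= /mrestr /mscale /= setTI fE.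
    by rewrite [X in (_ * X)%E](probability_setT P) mule1.
  - move=> B cB; have mB : measurable [set t | B (lay t y)].
      by apply: mlay; exact: sub_sigma_algebra.
    split=> //; move: cB mB => [S' ->] _.
    apply: (etrans (m1E _)); apply: (etrans _ (esym (m2E _))).
    have pair_inj : injective (pair y : I -> L * I) by move=> ? ? [].
    have -> : P [set t | forall s, s \in S' -> lay t y s] = (p ^+ #|` S'|)%:E.
      exact: (proj2 (bernoulli_field_reindex pair_inj bX) S').
    pose S'' := ([fset (y, s) | s in S'])%fset.
    have SS''0 : (S `&` S'' = fset0)%fset.
      apply/fsetP => s; rewrite !inE; apply/negP => /andP[/Sl sl].
      by move=> /imfsetP[i _ si]; move: sl; rewrite si /= inE eqxx.
    rewrite IH// -muleA -EFinM -exprD.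
    have -> : (#|` S| + #|` S'| = #|` (S `|` S'')%fset|)%N.
      by rewrite cardfsU SS''0 cardfs0 subn0 card_imfset.
    rewrite -IH//; last first.
      move=> s; rewrite inE => /orP[/Sl'//|/imfsetP[i _ ->]]; exact: yl.
    congr (P _); apply/seteqP; split=> t /=.
      move=> [h [hl hS]]; split=> // s; rewrite inE => /orP[/hS//|].
      by move=> /imfsetP[i /= /h hi ->].
    move=> [hl h]; split.
      by move=> s sS'; apply: (h (y, s)); rewrite inE in_imfset ?orbT.
    by split=> // s sS; apply: h; rewrite inE sS.
  have := etrans (esym (m1E (C y))) (etrans m12 (m2E (C y))).
  rewrite IH// => {}m12.
  rewrite big_cons -muleA muleC -m12; congr (P _); apply/seteqP; split=> t /=.
    move=> [h hS]; split; first by apply: h; rewrite inE eqxx.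
    by split=> // z zl; apply: h; rewrite inE zl orbT.
  move=> [h [hl hS]]; split=> // z; rewrite inE => /orP[/eqP ->//|]; exact: hl.
rewrite -[RHS]mule1; have := main J fset0 (fset_uniq J).
rewrite cardfs0 expr0 => <- //; congr (P _).
by apply/seteqP; split=> t /=; [move=> h; split|move=> []].
Qed.
End LayersIndependent.

(** * The coupling *)

Section CoverDomination.
Context {R : realType} {n : nat}.
Local Notation V := 'rV[int]_n.
Local Notation J := (nat * (V * nat))%type.

(** The columns are explored in the order of their codes; [pickle_inv], unlike
    [unpickle], visits every column exactly once. *)
Definition explored_layer (k : nat) (c : V * nat -> bool) : set (V * nat) :=
  if pickle_inv k is Some y then explored c [set y] else set0.

(** Layer 0 is reserved for the spare configuration. *)
Definition label (y : V) : nat := (choice.pickle y).+1.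

Definition merged (x : J -> bool) : V * nat -> bool := merge explored_layer x.

Lemma measurable_explored_layer k s :
  measurable [set c : configs (V * nat)%type | explored_layer k c s].
Proof.
rewrite /explored_layer; case: pickle_inv => [y|]; first exact: measurable_explored.
exact: (@measurable_cst_prop _ (configs (V * nat)%type) False).
Qed.

Lemma explored_layer_stopping k (c c' : V * nat -> bool) :
  (forall s, explored_layer k c s -> c s = c' s) ->
  explored_layer k c' = explored_layer k c.
Proof.
by rewrite /explored_layer; case: pickle_inv => // y; exact: explored_stopping.
Qed.

(** The site on the graph of [m] above [u] belongs to the region of a column [y]
    exactly when [f y u = m u].  So [merged x] has there the state of the layer
    of the first such [y], where this site is on the graph of [f y] and hence
    open. *)
Lemma merged_max_cover (x : J -> bool) (f : V -> V -> nat) (m : V -> nat) :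
  (forall y u k, cover_above (layer x (label y)) [set y] u k <-> (k < f y u)%N) ->
  (forall y, cover_family (layer x (label y)) [set y] (f y)) ->
  (forall y u, (f y u <= m u)%N) -> (forall u, exists y, f y u = m u) ->
  cover_family (merged x) setT m.
Proof.
move=> fP fC fm mf; split.
- apply/lipschitzP => u v uv; have [y <-] := mf u.
  have [/lipschitzP /(_ u v uv) fuv _ _] := fC y.
  by apply: leq_trans fuv _; rewrite ltnS.
- by move=> y _; have [_ fy _] := fC y; apply: leq_trans (fy y erefl) (fm y y).
- move=> u; right.
  have [y0 fy0] := mf u.
  have m0 : (0 < m u)%N.
    by have [_ fu _] := fC u; apply: leq_trans (fu u erefl) (fm u u).
  have ex : exists k, `[< exists2 y : V, pickle_inv k = Some y & f y u = m u >].
    by exists (choice.pickle y0); apply/asboolP; exists y0; rewrite ?pickleK_inv.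
  case: (ex_minnP ex) => k /asboolP[y ky fy] kmin.
  have kE : choice.pickle y = k.
    by have := @pickle_invK V k; rewrite ky /=.
  rewrite /merged /merge (@first_hit_least _ k).
  + have [_ _ /(_ u)] := fC y; rewrite fy /label kE => -[mu0|//].
    by rewrite mu0 in m0.
  + apply/asboolP; rewrite /explored_layer ky -kE; split=> //=.
    by apply/(fP y); rewrite fy prednK.
  + move=> i ik; apply/asboolPn; rewrite /explored_layer.
    case iy : (pickle_inv i) => [y'|]; last by case.
    move=> [_ /=].
    have iE : choice.pickle y' = i by have := @pickle_invK V i; rewrite iy /=.
    rewrite -iE => /(fP y'); rewrite prednK// => mfy'.
    have := kmin i; rewrite leqNgt ik => /(_ _)/negP; apply => //.
    apply/asboolP; exists y' => //; apply/eqP; rewrite eqn_leq fm /=.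
    exact: mfy'.
Qed.

(** If the supremum is finite at [v], then the Lipschitz bound makes it finite
    everywhere; being a supremum of natural numbers it is then attained, and
    [merged_max_cover] applies to it. *)
Lemma lowest_le_sup_covers (x : J -> bool) (v : V) :
  (cover_height (R := R) (merged x) setT v <=
   ereal_sup [set cover_height (layer x (label y)) [set y] v | y in setT])%E.
Proof.
set S := ereal_sup _.
have supS y : (cover_height (layer x (label y)) [set y] v <= S)%E.
  by apply: ereal_sup_ubound; exists y.
have [Soo|] := eqVneq S +oo%E; first by rewrite Soo leey.
rewrite -ltey => Soo.
have fin y : exists f, [/\ cover_family (layer x (label y)) [set y] f,
    cover_height (layer x (label y)) [set y] = (fun u => ((f u)%:R)%:E) :> (V -> \bar R) &
    forall u k, cover_above (layer x (label y)) [set y] u k <-> (k < f u)%N].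
  case: (@cover_height_cases R _ (layer x (label y)) [set y]) => // -[h _].
  by have := supS y; rewrite h leye_eq => /eqP Sy; rewrite Sy ltxx in Soo.
have [f fP] := choice fin.
have fS y : (((f y v)%:R : R)%:E <= S)%E.
  by have [_ h _] := fP y; have := supS y; rewrite h.
have [N fN] : exists N, forall y, (f y v <= N)%N.
  case: S Soo fS {supS} => [r _ fr|//|_ fr]; last by have := fr 0.
  exists (Num.truncn r).+1 => y.
  rewrite -(ler_nat R); apply: le_trans (ltW (truncnS_gt r)).
  by have := fr y; rewrite lee_fin.
have bnd u y : (f y u <= N + l1norm (u - v))%N.
  have [[lf _ _] _ _] := fP y; apply: leq_trans (lipschitz_l1norm u v lf) _.
  by rewrite leq_add2r.
have max u : exists m, (forall y, (f y u <= m)%N) /\ exists y, f y u = m.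
  have exu : exists k, `[< exists y, f y u = k >].
    by exists (f v u); apply/asboolP; exists v.
  have ubu k : `[< exists y, f y u = k >] -> (k <= N + l1norm (u - v))%N.
    by move=> /asboolP[y <-].
  case: (ex_maxnP exu ubu) => m /asboolP[y ym] mmax.
  by exists m; split; [move=> z; apply: mmax; apply/asboolP; exists z|exists y].
have [m mP] := choice max.
have Cm : cover_family (merged x) setT m.
  apply: (@merged_max_cover x f) => [y|y|y u|u].
  - by have [_ _] := fP y.
  - by have [] := fP y.
  - by have [] := mP u.
  - by have [] := mP u.
have [_ [y fy]] := mP v.
apply: le_trans (fS y); rewrite fy; apply: ereal_inf_lbound.
by exists m.
Qed.

End CoverDomination.

Lemma site_inj (d : nat) : (0 < d)%N ->
  injective (fun s : 'rV[int]_d.-1 * nat => site s.1 s.2).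
Proof.
case: d => // n _ [x h] [x' h'] /rowP e; congr (_, _).
  apply/rowP => i; have := e (widen_ord (leqnSn n) i); rewrite !mxE /=.
  by rewrite !(valK i).
by have := e ord_max; rewrite !mxE /= insubF ?ltnn//= => -[].
Qed.

Lemma percolation_bernoulli_field (R : realType) (d : nat) (p : R)
    (dW : measure_display) (W : measurableType dW) (P : probability W R)
    (omega : 'rV[int]_d -> {RV P >-> bool}) :
  site_percolation p omega ->
  bernoulli_field p P (fun w s => omega s w).
Proof.
move=> [ind hp]; split=> [s|S].
  rewrite (_ : [set w | _] = omega s @^-1` [set true]).
    by rewrite -[X in measurable X]setTI; exact: measurable_funP.
  by apply/seteqP; split=> w.
rewrite (_ : [set w | _] = \bigcap_(s in [set` S]) omega s @^-1` [set true]).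
  rewrite ind// (eq_bigr (fun=> p%:E)) => [|s _]; last first.
    by rewrite -(hp s); congr (P _); apply/seteqP; split=> w.
  rewrite prodEFin big_const_seq count_predT -Monoid.iteropE.
  by congr ((_ ^+ _)%:E).
by apply/seteqP; split=> w h s /h.
Qed.

Theorem theorem3 (R : realType) (d : nat) (hd : (2 <= d)%N)
    (p : R) (hp : 0 <= p <= 1)
    (dW : measure_display) (W : measurableType dW) (P : probability W R)
    (omega : 'rV[int]_d -> {RV P >-> bool})
    (hperc : site_percolation p omega)
    (dV : measure_display) (V : measurableType dV) (Q : probability V R)
    (g : 'rV[int]_d.-1 -> {RV Q >-> heights R d.-1})
    (hindep : independent_RVs g)
    (hlaw : forall (y : 'rV[int]_d.-1) (B : set (heights R d.-1)),
       measurable B ->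
       Q [set v | B (g y v)] =
       P [set w | B (local_cover R (fun s => omega s w) y)])
    (A : set (heights R d.-1)) (hA : measurable A) (hinc : increasing A) :
  (P [set w | A (lowest_open_lipschitz R (fun s => omega s w))] <=
   Q [set v | A (fun x => ereal_sup [set g y v x | y in setT])])%E.
Proof.
pose n := d.-1; pose half : countType := ('rV[int]_n * nat)%type.
pose halfspace w : half -> bool := fun s => omega (site s.1 s.2) w.
have lowestE w : lowest_open_lipschitz R (fun s => omega s w) =
    cover_height (halfspace w) setT.
  congr pointwise_min; apply/seteqP; split=> f /= [lf f0 fo]; split=> //.
  - by move=> x; right; exact: fo.
  - by move=> x; exact: f0.
  - by move=> x; case: (fo x) (f0 x I) => [->|].
have localE w y : local_cover R (fun s => omega s w) y =
    cover_height (halfspace w) [set y].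
  congr pointwise_min; apply/seteqP; split=> f /= [lf fy fo]; split=> //.
  - by move=> _ ->.
  - exact: fy.
have bW : bernoulli_field p P halfspace.
  exact: (bernoulli_field_reindex (site_inj (ltnW hd)) (percolation_bernoulli_field hperc)).
have [dT [T [Pr [X bX]]]] := @bernoulli_field_exists R p (nat * half)%type hp.
have bM : bernoulli_field p Pr (fun t => merged (X t)).
  apply: bernoulli_field_merge bX.
  - exact: measurable_explored_layer.
  - exact: explored_layer_stopping.
have label_inj : injective (fun s : 'rV[int]_n * half => (label s.1, s.2)).
  by move=> [y s] [y' s'] [/(pcan_inj choice.pickleK) -> ->].
have bL := bernoulli_field_reindex label_inj bX.
have blayer (y : 'rV[int]_n) : bernoulli_field p Pr (fun t => layer (X t) (label y)).
  have pair_inj : injective (pair (label y) : half -> _) by move=> ? ? [].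
  exact: bernoulli_field_reindex pair_inj bX.
pose cover t y : heights R n := cover_height (layer (X t) (label y)) [set y].
have mpre Y (B : set (heights R n)) : measurable B ->
    measurable [set c : configs half | B (cover_height c Y)].
  by move=> mB; rewrite -[X in measurable X]setTI; exact: measurable_cover_height.
have mfield d0 (T0 : measurableType d0) (F : T0 -> configs half) :
    (forall s, measurable [set t | F t s]) -> forall B : set (configs half),
    measurable B -> measurable [set t | B (F t)].
  move=> mF B mB; rewrite -[X in measurable X]setTI.
  exact: (measurable_configs mF).
have mcover y : measurable_fun setT (cover ^~ y).
  move=> _ B mB; rewrite setTI.
  apply: (mfield _ _ (fun t => layer (X t) (label y)) _ _ (mpre [set y] B mB)).
  by case: (blayer y).
rewrite (_ : [set w | _] = [set w | A (cover_height (halfspace w) setT)]); last first.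
  by apply/seteqP; split=> w /=; rewrite lowestE.
(* From here on the percolation configuration is the merged one. *)
rewrite (bernoulli_field_law bW bM (mpre setT A hA)).
pose sup_fam (a : 'rV[int]_n -> heights R n) : heights R n :=
  fun x => ereal_sup [set a y x | y in setT].
(* Both families are independent and have the same marginal laws. *)
have joint : Pr [set t | A (sup_fam (cover t))] =
    Q [set v | A (sup_fam (fun y => g y v))].
  pose fam := g_sigma_algebraType (@family_cylinders 'rV[int]_n _ (heights R n)).
  have mcoord y : measurable_fun setT (fun a : fam => a y).
    move=> _ B mB; rewrite setTI; apply: sub_sigma_algebra.
    exists [fset y]%fset, (fun=> B); split=> //; apply/seteqP; split=> a /=.
      by move=> Ba z; rewrite inE => /eqP ->.
    by apply; rewrite inE.
  apply: (@family_law _ _ _ _ Pr _ _ Q _ _ cover (fun v y => g y v) _ _ _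
    [set a | A (sup_fam a)]) => //.
  - move=> J C mC; rewrite -[LHS]/(Pr [set t | forall y, y \in J ->
      [set c : configs half | C y (cover_height c [set y])] (layer (X t) (label y))]).
    have mC' y := mpre [set y] (C y) (mC y).
    apply: (etrans (layers_independent bL J mC')).
    have -> : [set v | forall y, y \in J -> C y (g y v)] =
        \bigcap_(y in [set` J]) (g y @^-1` C y).
      by apply/seteqP; split=> v h y /h.
    rewrite hindep//; apply: eq_bigr => y _.
    apply: (etrans (bernoulli_field_law (blayer y) bW (mC' y))).
    rewrite -[RHS]/(Q [set v | C y (g y v)]) hlaw//.
    by congr (P _); apply/seteqP; split=> w /=; rewrite localE.
  - have := @measurable_sup_heights R n _ _ fam (fun a => a) mcoord measurableT A hA.
    by rewrite setTI.
rewrite -[leRHS]joint; apply: le_measure; rewrite ?inE.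
- by apply: (mfield _ _ (fun t => merged (X t)) _ _ (mpre setT A hA)); case: bM.
- have := @measurable_sup_heights R n _ _ T cover mcover measurableT A hA.
  by rewrite setTI.
- move=> t /= At; apply: (proj2 hinc) At _ => x; exact: lowest_le_sup_covers.
Qed.
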